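(* Suppose that there is $N_0\in\mathbb{N}$ such that for every integer $N\ge N_0$ the series $$\sum_{m=1}^\infty\frac{2^{\omega(m)}}{m}\Big|\sum_{d\mid m}\mu(d)\,C_{\Lambda,\Lambda_N}(N,m/d)\Big|$$ converges. Then for any given $h\in\mathbb{N}$ and every real number $\varepsilon>0$ one has $$\Delta(N,h)\ll_{\varepsilon}(N+h)^{\varepsilon},$$ that is, for every $\varepsilon>0$ there is a constant $K_\varepsilon>0$ depending only on $\varepsilon$ such that $|\Delta(N,h)|\le K_\varepsilon (N+h)^\varepsilon$ for all $h\in\mathbb{N}$ and all integers $N\ge N_0$.
   Context: $\mathbb{N}$ is the set of positive integers. $\omega(n)$ is the number of distinct prime factors of $n$, $\mu$ is the Möbius function, $\varphi$ is Euler's totient, $(m,n)$ is the greatest common divisor. $\Lambda$ is the von Mangoldt function, $\Lambda(n)=-\sum_{d\mid n}\mu(d)\log d$, so $\Lambda(n)=\log p$ if $n=p^\alpha$ with $p$ prime and $\alpha\in\mathbb{N}$, and $\Lambda(n)=0$ otherwise. For $q\in\mathbb{N}$, $\mathbb{Z}_q^*=\{m\in\mathbb{N}\cap[1,q]:(m,q)=1\}$, and the Ramanujan sum is $c_q(n)=\sum_{j\in\mathbb{Z}_q^*}\exp(2\pi i jn/q)$ for $n\in\mathbb{Z}$. For $N\in\mathbb{N}$, the incomplete $\Lambda$-function of range $N$ is $\Lambda_N(n)=-\sum_{d\le N,\ d\mid n}\mu(d)\log d$ for $n\in\mathbb{N}$, and for $q\le N$ $$\widehat{\Lambda_N}(q)=-\frac{\mu(q)}{q}\sum_{d\le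 N/q,\ (d,q)=1}\frac{\mu(d)\log(dq)}{d}.$$ The correlation of $\Lambda$ and $\Lambda_N$ is the arithmetic function $n\mapsto C_{\Lambda,\Lambda_N}(N,n)=\sum_{m\le N}\Lambda(m)\Lambda_N(m+n)$, $n\in\mathbb{N}$. Let $\psi(N;q,k)=\sum_{n\le N,\ n\equiv k\ (\mathrm{mod}\ q)}\Lambda(n)$ and $\delta(h;q,k)=c_q(k+h)-\frac{\mu(q)}{\varphi(q)}c_q(h)$. For $N\in\mathbb{N}$ and $h\in\mathbb{Z}$, $$\Delta(N,h)=\sum_{q\le N}\widehat{\Lambda_N}(q)\sum_{k\in\mathbb{Z}_q^*}\psi(N;q,k)\,\delta(h;q,k).$$ All summation variables range over positive integers. *)

(* Defs.v *)
From HB Require Import structures.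
From mathcomp Require Import all_boot all_order all_algebra.
From mathcomp Require Import all_classical all_reals all_analysis.
From mathcomp Require Import complex.

Set Implicit Arguments.
Unset Strict Implicit.
Unset Printing Implicit Defensive.

Import Order.TTheory GRing.Theory Num.Theory.
Import numFieldNormedType.Exports.

Local Open Scope ring_scope.
Local Open Scope complex_scope.

(** Arithmetic functions are total on [nat], but only their values at positive
    integers are meaningful: e.g. [mobius 0 = 1] is a junk value. *)

Definition omega (n : nat) : nat := size (primes n).

Definition squarefree (n : nat) : bool :=
  all (fun p => logn p n == 1%N) (primes n).

Definition mobius (n : nat) : int :=
  if squarefree n then (-1) ^+ omega n else 0.

Section Correlations.
Variable R : realType.

(** The truncated divisor sum - sum_(d <= N, d | n) mu(d) log d. *)
Definition Lambda_trunc (N n : nat) : R :=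
  - \sum_(1 <= d < N.+1 | (d %| n)%N) (mobius d)%:~R * ln d%:R.

Definition Lambda (n : nat) : R :=
  - \sum_(d <- divisors n) (mobius d)%:~R * ln d%:R.

(** The bound d <= N/q is written with the integer part of N/q. *)
Definition Lambda_trunc_hat (N q : nat) : R :=
  - ((mobius q)%:~R / q%:R) *
    \sum_(1 <= d < (N %/ q)%N.+1 | coprime d q)
      (mobius d)%:~R * ln (d * q)%N%:R / d%:R.

Definition correlation (f g : nat -> R) (N n : nat) : R :=
  \sum_(1 <= m < N.+1) f m * g (m + n)%N.

(** exp(i t) for real t. *)
Definition expi (t : R) : R[i] := cos t +i* sin t.

Definition ramanujan_sum (q : nat) (n : int) : R[i] :=
  \sum_(1 <= j < q.+1 | coprime j q) expi (2 * pi * j%:R * n%:~R / q%:R).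

Definition psi (N q k : nat) : R :=
  \sum_(1 <= n < N.+1 | (n == k %[mod q])%N) Lambda n.

Definition delta (h : int) (q k : nat) : R[i] :=
  ramanujan_sum q (k%:Z + h)
  - ((mobius q)%:~R / (totient q)%:R) * ramanujan_sum q h.

Definition Delta (N : nat) (h : int) : R[i] :=
  \sum_(1 <= q < N.+1) (Lambda_trunc_hat N q)%:C *
    \sum_(1 <= k < q.+1 | coprime k q) (psi N q k)%:C * delta h q k.

(** The m-th term (m >= 1) of
    sum_m (2 ^ omega(m) / m) |sum_(d | m) mu(d) C_(Lambda, Lambda_N)(N, m/d)|. *)
Definition eratosthenes_wintner_term (N m : nat) : R :=
  2 ^+ omega m / m%:R *
  `| \sum_(d <- divisors m) (mobius d)%:~R *
       correlation Lambda (Lambda_trunc N) N (m %/ d)%N |.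

End Correlations.

(* Main.v *)
(** Put [F h = correlation Lambda (Lambda_trunc N) N h], which is periodic in
    [h] with period [D = N!], and let [F'] be its Moebius transform. Convergence
    of the sum of [|F' d| / d] forces [F (u * h)] to be arbitrarily close to
    [F h] for all [u] prime to a suitable multiple [K] of [D]: average
    [F (h + D * k)], the sum of [F' d] over [d %| h + D * k], over [k < K]; the
    [d <= M] occur equally often for [h] and [u * h], because [k |-> u * k]
    permutes the residues mod [K], and the [d > M] contribute at most
    [(h + D)] times a tail of the series. Averaging over the units [u] mod [K]
    turns each Ramanujan sum [c_q (m + u * h)] in the finite expansion of [F]
    into [c_q m * c_q h / phi q], so that [F] equals its singular series exactly.
    Consequently only the terms with [gcd m q > 1] survive in [Delta]; there
    [m = p ^ a] and [p %| q], and trivial bounds for Ramanujan sums together with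
    [tau n << n ^ eps] give [|Delta| <= 4 * (1 + ln N) ^ 5 * (max tau) ^ 2]. *)

Require Import Defs.
From mathcomp Require Import all_boot all_order all_algebra.
From mathcomp Require Import all_classical all_reals all_analysis.
From mathcomp Require Import complex.
From mathcomp Require Import ring lra zify.

Set Implicit Arguments.
Unset Strict Implicit.
Unset Printing Implicit Defensive.

Import Order.TTheory GRing.Theory Num.Theory.
Import numFieldNormedType.Exports.

Local Open Scope classical_set_scope.
Local Open Scope ring_scope.
Local Open Scope complex_scope.

(** * The Moebius function *)

Lemma perm_primesM a b : (0 < a)%N -> (0 < b)%N -> coprime a b ->
  perm_eq (primes (a * b)) (primes a ++ primes b).
Proof.
move=> a0 b0 cab; apply: uniq_perm => [||q]; rewrite ?primes_uniq //.
  by rewrite cat_uniq !primes_uniq andbT /= -coprime_has_primes.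
by rewrite mem_cat primesM.
Qed.

Lemma mobius_coprime a b : (0 < a)%N -> (0 < b)%N -> coprime a b ->
  mobius (a * b) = mobius a * mobius b.
Proof.
move=> a0 b0 cab; have pm := perm_primesM a0 b0 cab.
have ndvd q c d : prime q -> coprime c d -> (q %| c)%N -> coprime q d.
  move=> pq cd qc; rewrite prime_coprime //; apply/negP => qd.
  have : (q %| gcdn c d)%N by rewrite dvdn_gcd qc.
  by rewrite (eqP cd) dvdn1 gtn_eqF ?prime_gt1.
have sq : squarefree (a * b) = squarefree a && squarefree b.
  rewrite /squarefree (perm_all _ pm) all_cat.
  congr (_ && _); apply: eq_in_all => q; rewrite mem_primes => /and3P[pq _ qd].
    by rewrite mulnC logn_Gauss // (ndvd _ a).
  by rewrite logn_Gauss // (ndvd _ b) // coprime_sym.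
rewrite /mobius sq /omega (perm_size pm) size_cat.
by case: (squarefree a); case: (squarefree b); rewrite ?mul0r ?mulr0 // exprD.
Qed.

Lemma mobiusM p d : prime p -> (0 < d)%N -> ~~ (p %| d)%N ->
  mobius (p * d) = - mobius d.
Proof.
move=> pp d0 pd; rewrite (mobius_coprime (prime_gt0 pp) d0) ?prime_coprime //.
rewrite [mobius p]/mobius /squarefree /omega primes_prime //= logn_prime // eqxx /=.
by rewrite expr1 mulN1r.
Qed.

Lemma mobius_sqr0 p d : prime p -> (0 < d)%N -> (p ^ 2 %| d)%N -> mobius d = 0.
Proof.
move=> pp d0 pd; rewrite /mobius; case: ifP => // /allP/(_ p).
rewrite mem_primes pp d0 (dvdn_trans _ pd) ?dvdn_exp // => /(_ isT) /eqP.
by move: pd; rewrite pfactor_dvdn // => /[swap] ->.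
Qed.

Lemma mobius_ncoprime a b : (0 < a)%N -> (0 < b)%N -> ~~ coprime a b ->
  mobius (a * b) = 0.
Proof.
move=> a0 b0; rewrite coprime_has_primes // negbK => /hasP[p].
rewrite !mem_primes => /and3P[pp _ pb] /and3P[_ _ pa].
by rewrite (@mobius_sqr0 p) // ?muln_gt0 ?a0 // -mulnn dvdn_mul.
Qed.

Lemma norm_mobius_le1 (R : numDomainType) n : `|(mobius n)%:~R : R| <= 1.
Proof.
rewrite /mobius; case: ifP => _; last by rewrite normr0 ler01.
by rewrite rmorphXn /= normrX normrN1 expr1n.
Qed.

(** * Reindexing of sums over divisors *)

Lemma big_divisors_nat (V : nmodType) (F : nat -> V) n B :
  (0 < n)%N -> (n <= B)%N ->
  \sum_(d <- divisors n) F d = \sum_(1 <= d < B.+1 | (d %| n)%N) F d.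
Proof.
move=> n0 nB; rewrite -[RHS]big_filter; apply: perm_big.
apply: uniq_perm => [||d]; rewrite ?divisors_uniq ?filter_uniq ?iota_uniq //.
rewrite mem_filter mem_index_iota -dvdn_divisors //.
case dn: (d %| n)%N => //=.
by rewrite (dvdn_gt0 n0 dn) ltnS (leq_trans _ nB) // dvdn_leq.
Qed.

Lemma big_divisors_dvd (V : nmodType) (F : nat -> V) m n :
  (0 < n)%N -> (m %| n)%N ->
  \sum_(d <- divisors m) F d = \sum_(d <- divisors n | (d %| m)%N) F d.
Proof.
move=> n0 mn; rewrite -[RHS]big_filter; apply: perm_big.
apply: uniq_perm => [||d]; rewrite ?divisors_uniq ?filter_uniq ?divisors_uniq //.
rewrite mem_filter -!dvdn_divisors ?(dvdn_gt0 n0 mn) //.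
by case dm: (d %| m)%N => //=; rewrite (dvdn_trans dm mn).
Qed.

Lemma big_divisors_mul (V : nmodType) (F : nat -> V) e n :
  (0 < n)%N -> (e %| n)%N ->
  \sum_(m <- divisors n | (e %| m)%N) F m =
  \sum_(k <- divisors (n %/ e)) F (e * k)%N.
Proof.
move=> n0 en; have e0 := dvdn_gt0 n0 en.
rewrite -big_filter -[RHS](big_map (muln e) predT); apply: perm_big.
have inj : injective (muln e) by move=> x y /eqP; rewrite eqn_pmul2l // => /eqP.
apply: uniq_perm => [||m]; rewrite ?filter_uniq ?map_inj_uniq ?divisors_uniq //.
have q0 : (0 < n %/ e)%N by rewrite divn_gt0 // dvdn_leq.
rewrite mem_filter -dvdn_divisors //; apply/andP/mapP => [[em mn]|[k]].
  exists (m %/ e)%N; last by rewrite mulnC divnK.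
  by rewrite -dvdn_divisors // -(dvdn_pmul2l e0) mulnC divnK // mulnC divnK.
rewrite -dvdn_divisors // => kn ->; split; first exact: dvdn_mulr.
by rewrite -(divnK en) mulnC dvdn_mul.
Qed.

Lemma big_divisors_rev (V : nmodType) (F : nat -> V) n : (0 < n)%N ->
  \sum_(d <- divisors n) F d = \sum_(d <- divisors n) F (n %/ d)%N.
Proof.
move=> n0; rewrite -[RHS](big_map (divn n) predT); apply: perm_big.
have inv d : (d %| n)%N -> (n %/ (n %/ d))%N = d by move=> dn;
  rewrite divnA // mulKn.
apply: uniq_perm => [||m]; rewrite ?divisors_uniq //.
  rewrite map_inj_in_uniq ?divisors_uniq // => x y; rewrite -!dvdn_divisors //.
  by move=> xn yn exy; rewrite -(inv x) // exy inv.
rewrite -dvdn_divisors //; apply/idP/mapP => [mn|[d]].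
  by exists (n %/ m)%N; rewrite -?dvdn_divisors // ?dvdn_div ?inv.
by rewrite -dvdn_divisors // => dn ->; exact: dvdn_div.
Qed.

Section MobiusSums.
Variable R : pzRingType.
Implicit Type F : nat -> R.

(** Divisors divisible by [p ^ 2] drop out; the others are [d] and [p * d] with [d %| n], and these
    have opposite Moebius values. This peels one prime off any Moebius sum. *)
Lemma sum_mobius_primepow F p a n :
  prime p -> (0 < a)%N -> (0 < n)%N -> ~~ (p %| n)%N ->
  \sum_(d <- divisors (p ^ a * n)) (mobius d)%:~R * F d =
  \sum_(d <- divisors n) (mobius d)%:~R * (F d - F (p * d)%N).
Proof.
move=> pp a0 n0 pn; have p0 := prime_gt0 pp.
have N0 : (0 < p ^ a * n)%N by rewrite muln_gt0 expn_gt0 p0.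
rewrite (bigID (fun d => (p ^ 2 %| d)%N)) /= big_seq_cond big1 ?add0r; last first.
  move=> d /andP[]; rewrite -dvdn_divisors // => dN pd.
  by rewrite (mobius_sqr0 pp _ pd) ?mul0r // (dvdn_gt0 N0 dN).
have -> : \sum_(d <- divisors n) (mobius d)%:~R * (F d - F (p * d)%N) =
    \sum_(d <- divisors n ++ map (muln p) (divisors n)) (mobius d)%:~R * F d.
  rewrite big_cat big_map /= -big_split /= [LHS]big_seq [RHS]big_seq.
  apply: eq_bigr => d; rewrite -dvdn_divisors // => dn.
  rewrite mobiusM ?(dvdn_gt0 n0 dn) //;
    last by apply: contra pn => /dvdn_trans; apply.
  by rewrite rmorphN /= mulNr mulrBr.
rewrite -big_filter; apply: perm_big.
have inj : injective (muln p) by move=> x y /eqP; rewrite eqn_pmul2l // => /eqP.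
have cpn d : ~~ (p %| d)%N -> (d %| p ^ a * n)%N -> (d %| n)%N.
  by move=> pd; rewrite Gauss_dvdr // coprime_sym coprimeXl // prime_coprime.
apply: uniq_perm => [||d]; rewrite ?filter_uniq ?divisors_uniq //.
  rewrite cat_uniq map_inj_uniq // !divisors_uniq andbT /=.
  apply/hasPn => _ /mapP[d _ ->] /=; rewrite -dvdn_divisors //.
  by apply: contra pn => /(dvdn_trans _); apply; exact: dvdn_mulr.
rewrite mem_filter mem_cat -!dvdn_divisors //.
apply/andP/orP => [[p2d dN]|[dn|/mapP[e]]].
- have [/dvdnP[e ed]|pd] := boolP (p %| d)%N; last by left; exact: cpn.
  right; apply/mapP; exists e; last by rewrite ed mulnC.
  rewrite -dvdn_divisors //; apply: cpn; last first.
    by apply: dvdn_trans dN; rewrite ed dvdn_mulr.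
  by apply: contra p2d => pe; rewrite ed -mulnn dvdn_mul.
- split; last exact: dvdn_mull.
  apply: contra pn => /dvdn_trans/(_ dn); apply: dvdn_trans.
  by rewrite dvdn_exp.
- rewrite -dvdn_divisors // => en ->; split.
    rewrite -mulnn dvdn_pmul2l //; apply: contra pn => /dvdn_trans; exact.
  by rewrite dvdn_mul // dvdn_exp.
Qed.

Lemma pdiv_split n : (1 < n)%N ->
  exists p a m, [/\ prime p, (0 < a)%N, (0 < m)%N, ~~ (p %| m)%N
                 & n = (p ^ a * m)%N].
Proof.
move=> n1; have n0 : (0 < n)%N by apply: ltnW.
have pp := pdiv_prime n1.
have [m cm en] := pfactor_coprime pp n0.
exists (pdiv n), (logn (pdiv n) n), m; split => //; last by rewrite mulnC.
- by rewrite logn_gt0 pi_pdiv.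
- by move: n0; rewrite en muln_gt0 => /andP[].
- by rewrite -prime_coprime.
Qed.

Lemma sum_mobius n : (0 < n)%N ->
  \sum_(d <- divisors n) (mobius d)%:~R = (n == 1%N)%:R :> R.
Proof.
move=> n0; have [->|n1] := eqVneq n 1%N; first by rewrite big_seq1.
have [|p [a [m [pp a0 m0 pm ->]]]] := @pdiv_split n.
  by rewrite ltn_neqAle eq_sym n1.
under eq_bigr do rewrite -[_%:~R]mulr1.
rewrite (sum_mobius_primepow (fun=> 1)) // big1 // => d _.
by rewrite subrr mulr0.
Qed.

(** After exchanging the sums, [F e] carries the sum of [mobius k] over [k %| n %/ e], which
    vanishes unless [e = n]. *)
Lemma mobius_inversion F n : (0 < n)%N ->
  \sum_(m <- divisors n) \sum_(d <- divisors m) (mobius d)%:~R * F (m %/ d)%N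
  = F n.
Proof.
move=> n0; transitivity (\sum_(m <- divisors n)
    \sum_(e <- divisors n | (e %| m)%N) (mobius (m %/ e))%:~R * F e).
  rewrite !big_seq; apply: eq_bigr => m; rewrite -dvdn_divisors // => mn.
  have m0 := dvdn_gt0 n0 mn.
  rewrite big_divisors_rev // -(big_divisors_dvd _ n0 mn).
  rewrite !big_seq; apply: eq_bigr => d; rewrite -dvdn_divisors // => dm.
  by congr (_ * F _); rewrite divnA // mulKn.
rewrite (exchange_big_dep xpredT) //= (bigD1_seq n) ?divisors_id ?divisors_uniq //=.
rewrite big_divisors_mul // divnn n0 big_seq1 muln1 divnn n0 mul1r.
rewrite big_seq_cond big1 ?addr0 // => e /andP[];
  rewrite -dvdn_divisors // => en ne.
have e0 := dvdn_gt0 n0 en.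
rewrite big_divisors_mul // -mulr_suml.
under eq_bigr do rewrite mulKn //.
have q0 : (0 < n %/ e)%N by rewrite divn_gt0 // dvdn_leq.
rewrite sum_mobius //; case: eqP => [q1|]; last by rewrite mul0r.
by move: ne; rewrite -(divnK en) q1 mul1n eqxx.
Qed.

End MobiusSums.

(** * Residue classes *)

Lemma lift_coprime q K j : (0 < j)%N -> (0 < K)%N -> coprime j q ->
  exists2 t, (0 < t)%N & (t = j %[mod q]) /\ coprime t K.
Proof.
(* Every prime of [K] divides exactly one of [j] and [q * t]. *)
move=> j0 K0 cjq; pose t := (K`_(\pi(j)^'))%N.
have t0 : (0 < t)%N by exact: part_gt0.
exists (j + t * q)%N; first by rewrite addn_gt0 j0.
split; first by rewrite addnC modnMDl.
rewrite coprime_sym coprime_has_primes ?addn_gt0 ?j0 //.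
apply/hasPn => p; rewrite mem_primes => /and3P[pp _ pjq].
apply/negP; rewrite mem_primes => /and3P[_ _ pK].
have [pj|pj] := boolP (p %| j)%N.
  have ptq : (p %| t * q)%N by rewrite -(dvdn_addr _ pj).
  move: ptq; rewrite Euclid_dvdM // => /orP[pt|pq].
    have := pnatP _ t0 (part_pnat (\pi(j)^')%N K) => /(_ p pp pt).
    by rewrite inE /= mem_primes pp j0 pj.
  have : (p %| gcdn j q)%N by rewrite dvdn_gcd pj.
  by rewrite (eqP cjq) dvdn1 => /eqP p1; rewrite p1 in pp.
have pt : (p %| t)%N.
  rewrite -(partnC (\pi(j)) K0) Euclid_dvdM // in pK.
  case/orP: pK => // pK; have := pnatP _ (part_gt0 _ _) (part_pnat \pi(j) K).
  by move=> /(_ p pp pK); rewrite mem_primes (negbTE pj) !andbF.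
by move: pj; rewrite -(dvdn_addl _ (dvdn_mulr q pt)) pjq.
Qed.

Lemma eqn_modMl_coprime u K a b : coprime u K ->
  (u * a == u * b %[mod K]) = (a == b %[mod K]).
Proof.
move=> cu; wlog ab : a b / (a <= b)%N.
  by move=> W; case/orP: (leq_total a b) => /W //; rewrite eq_sym [RHS]eq_sym.
rewrite eq_sym [RHS]eq_sym !eqn_mod_dvd ?leq_mul2l ?ab ?orbT //.
by rewrite -mulnBr Gauss_dvdr // coprime_sym.
Qed.

Section PeriodicSums.
Variables (V : nmodType) (K : nat) (f : nat -> V).
Hypotheses (K0 : (0 < K)%N) (fK : forall n, f (n %% K) = f n).

Lemma sum_period_mul u : coprime u K ->
  \sum_(0 <= k < K) f (u * k)%N = \sum_(0 <= k < K) f k.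
Proof.
move=> cu; rewrite !big_mkord.
pose g (k : 'I_K) := Ordinal (ltn_pmod (u * k) K0).
have gI : injective g.
  move=> a b /(congr1 val) /= /eqP; rewrite eqn_modMl_coprime //.
  by rewrite !modn_small // => /eqP/val_inj.
rewrite [RHS](reindex_inj gI) /=; apply: eq_bigr => k _.
by rewrite fK.
Qed.

Lemma sum_period_shift : \sum_(1 <= k < K.+1) f k = \sum_(0 <= k < K) f k.
Proof.
rewrite big_nat_recr //= -(fK K) modnn addrC -big_ltn //.
Qed.

Lemma sum_period_eqmod n :
  \sum_(0 <= k < K | (n == k %[mod K])%N) f k = f n.
Proof.
rewrite big_mkord (bigD1 (Ordinal (ltn_pmod n K0))) /=; last by rewrite modn_mod.
rewrite big1 ?addr0 ?fK // => i /andP[/eqP ni].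
by rewrite -val_eqE /= ni modn_small ?eqxx.
Qed.

End PeriodicSums.

Lemma sum_unit_mul (V : nmodType) K (f : nat -> V) j : (0 < K)%N ->
  (forall n, f (n %% K)%N = f n) -> coprime j K ->
  \sum_(1 <= u < K.+1 | coprime u K) f (j * u)%N =
  \sum_(1 <= u < K.+1 | coprime u K) f u.
Proof.
move=> K0 fK cj; rewrite big_mkcond [RHS]big_mkcond /=.
(* Extension by zero off the units preserves periodicity, so that the sum over units becomes a sum
   over a full period. *)
pose g n := if coprime n K then f n else 0.
have gK n : g (n %% K)%N = g n by rewrite /g coprime_modl fK.
rewrite [RHS](sum_period_shift K0 gK) -(sum_period_mul K0 gK cj).
rewrite -[RHS](@sum_period_shift _ K (fun k => g (j * k)%N)) //; last first.
  by move=> n; rewrite -gK modnMmr gK.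
by apply: eq_bigr => u _; rewrite /g coprimeMl cj.
Qed.

Lemma sum_unit_eqmod (V : nmodType) q (f : nat -> V) n : (0 < q)%N ->
  (forall n, f (n %% q)%N = f n) ->
  \sum_(1 <= k < q.+1 | coprime k q && (n == k %[mod q])%N) f k =
  if coprime n q then f n else 0.
Proof.
move=> q0 fq; rewrite big_mkcond /=.
pose g k := if coprime k q then f k else 0.
have gq k : g (k %% q)%N = g k by rewrite /g coprime_modl fq.
rewrite -/(g n) -[RHS](sum_period_eqmod q0 gq).
rewrite [RHS]big_mkcond /= -[RHS](@sum_period_shift _ q (fun k => if (n == k
  %[mod q])%N then g k else 0)) //.
  by apply: eq_bigr => k _; rewrite /g; case: (coprime k q); case: eqP.
by move=> k; rewrite modn_mod gq.
Qed.

Lemma big_nat_dvd (V : nmodType) d B (F : nat -> V) : (0 < d)%N ->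
  \sum_(1 <= j < B.+1 | (d %| j)%N) F j = \sum_(1 <= i < (B %/ d).+1) F (d * i)%N.
Proof.
move=> d0; rewrite -big_filter -[RHS](big_map (muln d) predT); apply: perm_big.
have inj : injective (muln d) by move=> x y /eqP; rewrite eqn_pmul2l // => /eqP.
apply: uniq_perm => [||j]; rewrite ?filter_uniq ?map_inj_uniq ?iota_uniq //.
rewrite mem_filter mem_index_iota; apply/and3P/mapP => [[dj j0 jB]|[k]].
  exists (j %/ d)%N; last by rewrite mulnC divnK.
  by rewrite mem_index_iota divn_gt0 // dvdn_leq //= ltnS leq_div2r.
rewrite mem_index_iota => /andP[k0 kB] ->; rewrite dvdn_mulr // muln_gt0 d0 k0.
by move: kB; rewrite !ltnS leq_divRL // mulnC.
Qed.

Lemma totient_count n : (0 < n)%N ->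
  totient n = (\sum_(1 <= d < n.+1 | coprime d n) 1)%N.
Proof.
move=> n0; rewrite totient_count_coprime [RHS]big_mkcond /=.
pose f d : nat := coprime d n.
transitivity (\sum_(0 <= d < n) f d)%N.
  by apply: eq_bigr => i _; rewrite /f coprime_sym.
rewrite -(@sum_period_shift nat n f) //.
by move=> k; rewrite /f coprime_modl.
Qed.

(** * Ramanujan sums *)

Section RamanujanSums.
Variable R : realType.
Implicit Types (m n q d K h : nat).

Lemma expiD (s t : R) : expi (s + t) = expi s * expi t.
Proof. by rewrite /expi sinD cosD; simpc; congr (_ +i* _); rewrite addrC. Qed.

Lemma expiMn (t : R) n : expi (t * n%:R) = expi t ^+ n.
Proof.
elim: n => [|n IH]; first by rewrite mulr0 expr0 /expi sin0 cos0.
by rewrite -natr1 mulrDr mulr1 expiD IH exprSr.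
Qed.

(** By the double-angle formula [cos t = 1] forces [sin (t / 2) = 0], but [0 < t / 2 < pi]. *)
Lemma expi_neq1 (t : R) : 0 < t < 2 * pi -> expi t != 1.
Proof.
move=> /andP[t0 tpi]; apply/eqP => -[ct _].
have s0 : 0 < sin (t / 2) by apply: sin_gt0_pi; lra.
have c := cosD (t / 2) (t / 2); have := cos2Dsin2 (t / 2).
rewrite -splitr ct in c; rewrite !expr2 => cs.
have : 0 < sin (t / 2) * sin (t / 2) by rewrite mulr_gt0.
by lra.
Qed.

Definition zeta q : R[i] := expi (2 * pi / q%:R).

Lemma zeta_expn q : (0 < q)%N -> zeta q ^+ q = 1.
Proof.
move=> q0; rewrite /zeta -expiMn divfK ?pnatr_eq0 -?lt0n //.
by rewrite /expi mulr_natl cos2pi sin2pi.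
Qed.

Lemma zeta_expnM d r : (0 < d)%N -> zeta (d * r) ^+ d = zeta r.
Proof.
move=> d0; rewrite /zeta -expiMn natrM invfM; congr expi.
by rewrite mulrA mulrAC divfK // pnatr_eq0 -lt0n.
Qed.

Lemma zeta_expr_mod q n : (0 < q)%N -> zeta q ^+ (n %% q) = zeta q ^+ n.
Proof. by move=> q0; rewrite expr_mod ?zeta_expn. Qed.

Lemma sum_zeta r n : (0 < r)%N ->
  \sum_(1 <= j < r.+1) zeta r ^+ (j * n) = (r * (r %| n))%:R.
Proof.
move=> r0; have [rn|rn] := boolP (r %| n)%N.
  rewrite muln1 (eq_bigr (fun=> 1)) ?sumr_const_nat ?subn1 // => j _.
  by rewrite -zeta_expr_mod // (eqP (dvdn_mull j rn)) expr0.
(* Multiplying by this nonzero factor telescopes the geometric sum to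
   [zeta r ^+ (r * n) - 1 = 0]. *)
have w1 : zeta r ^+ n - 1 != 0.
  rewrite subr_eq0 -zeta_expr_mod // /zeta -expiMn expi_neq1 //.
  have rR : 0 < r%:R :> R by rewrite ltr0n.
  have m0 : 0 < (n %% r)%:R :> R by rewrite ltr0n lt0n.
  have mr : (n %% r)%:R < r%:R :> R by rewrite ltr_nat ltn_mod.
  have p0 := @pi_gt0 R.
  have pp0 : 0 < 2 * pi :> R by rewrite mulr_gt0.
  rewrite -[_ * (n %% r)%:R]mulrA (mulrC r%:R^-1) mulr_gt0 ?divr_gt0 //=.
  by rewrite gtr_pMr // ltr_pdivrMr // mul1r.
rewrite muln0; apply: (mulfI w1); rewrite mulr0.
rewrite (eq_bigr (fun j => (zeta r ^+ n) ^+ j)); last first.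
  by move=> j _; rewrite mulnC exprM.
rewrite (@sum_period_shift _ r (fun j => (zeta r ^+ n) ^+ j)) //; last first.
  by move=> j; rewrite expr_mod // -exprM mulnC exprM zeta_expn // expr1n.
by rewrite big_mkord -subrX1 -exprM mulnC exprM zeta_expn // expr1n subrr.
Qed.

(** Kluyver's formula for the Ramanujan sum [c_q n]: real, and a Moebius transform by construction.
    [ramanujan_sumE] identifies it with the exponential sum. *)
Definition ram q n : R :=
  \sum_(d <- divisors q) (mobius d)%:~R * ((q %/ d) * (q %/ d %| n))%:R.

Lemma sum_ram_divisors d n : (0 < d)%N ->
  \sum_(q <- divisors d) ram q n = (d * (d %| n))%:R.
Proof. by move=> d0; rewrite (mobius_inversion (fun e => (e * (e %| n))%:R)). Qed.

Lemma eq_ram q n m : (0 < q)%N ->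
  (forall d, (d %| q)%N -> (d %| n)%N = (d %| m)%N) -> ram q n = ram q m.
Proof.
move=> q0 nm; rewrite /ram !big_seq; apply: eq_bigr => d.
by rewrite -dvdn_divisors // => dq; rewrite nm // dvdn_div.
Qed.

Lemma ram_mod q K n : (0 < q)%N -> (q %| K)%N -> ram q (n %% K) = ram q n.
Proof.
move=> q0 qK; apply: eq_ram => // d dq; rewrite /dvdn modn_dvdm //.
exact: dvdn_trans qK.
Qed.

Lemma ram_unit q u n : (0 < q)%N -> coprime u q -> ram q (u * n) = ram q n.
Proof.
move=> q0 uq; apply: eq_ram => // d dq; rewrite Gauss_dvdr // coprime_sym.
exact: coprime_dvdr uq.
Qed.

Lemma ramanujan_sum_zeta q n : ramanujan_sum R q n =
  \sum_(1 <= j < q.+1 | coprime j q) zeta q ^+ (j * n).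
Proof.
apply: eq_bigr => j _; rewrite -expiMn natrM; congr expi.
by rewrite -!mulrA; congr (_ * (_ * _)); rewrite [RHS]mulrC -mulrA.
Qed.

(** Coprimality of [j] and [q] is detected by the sum of [mobius d] over [d %| gcdn j q]; for each
    [d], the [j] divisible by [d] form a complete sum of powers of [zeta (q %/ d)]. *)
Lemma ramanujan_sumE q n : (0 < q)%N -> ramanujan_sum R q n = (ram q n)%:C.
Proof.
move=> q0; rewrite ramanujan_sum_zeta rmorph_sum /=.
transitivity (\sum_(1 <= j < q.+1) \sum_(d <- divisors q | (d %| j)%N)
   (mobius d)%:~R * zeta q ^+ (j * n)).
  rewrite big_mkcond /= !big_nat; apply: eq_bigr => j /andP[j0 _].
  rewrite -mulr_suml.
  have g0 : (0 < gcdn j q)%N by rewrite gcdn_gt0 j0.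
  transitivity ((\sum_(d <- divisors (gcdn j q)) (mobius d)%:~R) * zeta q ^+ (j
    * n)).
    by rewrite sum_mobius // /coprime; case: eqP; rewrite ?mul1r ?mul0r.
  rewrite (big_divisors_dvd _ q0 (dvdn_gcdr j q)); congr (_ * _).
  rewrite big_seq_cond [RHS]big_seq_cond; apply: eq_bigl => d.
  rewrite -dvdn_divisors // dvdn_gcd.
  by case: (d %| q)%N; rewrite ?andbT ?andbF.
rewrite (exchange_big_dep xpredT) //= !big_seq; apply: eq_bigr => d.
rewrite -dvdn_divisors // => dq; have d0 := dvdn_gt0 q0 dq.
rewrite -mulr_sumr rmorphM /= rmorph_int rmorph_nat; congr (_ * _).
rewrite -sum_zeta ?divn_gt0 // 1?dvdn_leq // big_nat_dvd //.
apply: eq_bigr => j _; rewrite -mulnA exprM.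
by rewrite -{1}(divnK dq) mulnC zeta_expnM.
Qed.

(** Expand [c_q (m + u * h)] into exponentials. The inner sum [S j] over [u] is the same for all [j]
    prime to [q], because such a [j] lifts to a unit mod [K] that can be absorbed into [u]; hence
    [c_q m] factors out. *)
Lemma ram_unit_average q K m h : (0 < K)%N -> (q %| K)%N ->
  (\sum_(1 <= u < K.+1 | coprime u K) ram q (m + u * h)) * (totient q)%:R =
  (totient K)%:R * (ram q m * ram q h).
Proof.
move=> K0 qK; have q0 := dvdn_gt0 K0 qK; apply: complexI.
rewrite !rmorphM /= !rmorph_nat rmorph_sum /=.
pose S j := \sum_(1 <= u < K.+1 | coprime u K) zeta q ^+ (j * (u * h)).
have SE j : (0 < j)%N -> coprime j q -> S j = S 1%N.
  move=> j0 cj; have [t t0 [tj ct]] := lift_coprime j0 K0 cj.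
  rewrite /S -(@sum_unit_mul _ K (fun u => zeta q ^+ (1 * (u * h))) t) //.
    apply: eq_bigr => u _; rewrite mul1n -mulnA.
    by rewrite -zeta_expr_mod // -[RHS]zeta_expr_mod // -modnMml -tj modnMml.
  move=> u; rewrite !mul1n -zeta_expr_mod // -[RHS]zeta_expr_mod //.
  by rewrite -modnMml modn_dvdm // modnMml.
have -> : \sum_(1 <= u < K.+1 | coprime u K) (ram q (m + u * h))%:C =
    S 1%N * (ram q m)%:C.
  rewrite -(ramanujan_sumE m q0) ramanujan_sum_zeta mulr_sumr.
  transitivity (\sum_(1 <= u < K.+1 | coprime u K)
      \sum_(1 <= j < q.+1 | coprime j q) zeta q ^+ (j * m) * zeta q ^+ (j * (u
        * h))).
    apply: eq_bigr => u _; rewrite -ramanujan_sumE // ramanujan_sum_zeta.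
    by apply: eq_bigr => j _; rewrite mulnDr exprD.
  rewrite exchange_big /= big_nat_cond [RHS]big_nat_cond.
  apply: eq_bigr => j /andP[/andP[j0 _] cj].
  by rewrite -mulr_sumr -/(S j) SE // mulrC.
(* What remains is the value of [S 1]: summing [S j] over all [j] prime to [q] and exchanging gives
   [c_q (u * h) = c_q h] for every unit [u]. *)
rewrite mulrAC [RHS]mulrCA [RHS]mulrC; congr (_ * _).
rewrite mulrC totient_count // natr_sum mulr_suml.
transitivity (\sum_(1 <= j < q.+1 | coprime j q) S j).
  rewrite big_nat_cond [RHS]big_nat_cond.
  by apply: eq_bigr => j /andP[/andP[j0 _] cj]; rewrite mul1r SE.
rewrite exchange_big /= totient_count // natr_sum mulr_suml.
apply: eq_bigr => u cu; rewrite mul1r -ramanujan_sum_zeta ramanujan_sumE //.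
by rewrite ram_unit // (coprime_dvdr qK).
Qed.

End RamanujanSums.

(** * Dilation invariance from Wintner's condition *)

Section Wintner.
Variable R : realType.
Implicit Types (m n q d K h u : nat).

(** The terms counted are distinct positive multiples of [d] below [n + D * K]; the sharper form
    with [.-1] carries the induction on [K]. *)
Lemma count_dvd_progression n D d K : (0 < n)%N -> (0 < D)%N -> (0 < d)%N ->
  ((\sum_(0 <= k < K) (d %| n + D * k)) * d <= n + D * K)%N.
Proof.
move=> n0 D0 d0; suff: (\sum_(0 <= k < K) (d %| n + D * k) <= (n + D * K).-1 %/
  d)%N.
  by rewrite leq_divRL // => /leq_trans; apply; rewrite leq_pred.
elim: K => [|K IH]; first by rewrite big_geq.
rewrite big_nat_recr //=; have [/dvdnP[t et]|_] := boolP (d %| n + D * K)%N;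
  last first.
  by rewrite addn0 (leq_trans IH) // leq_div2r // mulnS; lia.
have t0 : (0 < t)%N by case: t et => // /eqP; rewrite addn_eq0 -leqn0 leqNgt n0.
apply: (@leq_trans t).
  rewrite addn1; apply: leq_ltn_trans IH _; rewrite et ltn_divLR //.
  by rewrite prednK ?muln_gt0 ?t0.
by rewrite leq_divRL // -et mulnS; lia.
Qed.

Section Dilation.
Variables (F : nat -> R) (D : nat).
Hypotheses (D0 : (0 < D)%N) (FD : forall n, F (n + D) = F n).

Let F' m : R := \sum_(d <- divisors m) (mobius d)%:~R * F (m %/ d)%N.

Hypothesis F'_cvg : cvgn (series (fun j => `|F' j.+1| / j.+1%:R)).

Lemma wintner_tail (e : R) : 0 < e ->
  exists M, forall B, (M <= B)%N -> \sum_(M <= j < B) `|F' j.+1| / j.+1%:R <= e.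
Proof.
move=> e0; pose v j : R := `|F' j.+1| / j.+1%:R.
have nd : nondecreasing_seq (series v).
  by apply/nondecreasing_seqP => n;
    rewrite /series /= big_nat_recr //= lerDl divr_ge0.
have /cvgrPdist_le/(_ _ e0)[M _ HM] : cvgn (series v) := F'_cvg.
exists M => B MB; rewrite -(@sub_series_geq _ v) //.
have := HM M (leqnn M);
  have := nondecreasing_cvgn_le nd (F'_cvg : cvgn (series v)) B.
by move=> /= lB; rewrite ler_norml => /andP[_ lM]; lra.
Qed.

Lemma sum_progression n K B : (0 < n)%N -> (n + D * K <= B)%N ->
  K%:R * F n = \sum_(1 <= d < B.+1) F' d * (\sum_(0 <= k < K) (d %| n + D * k))%:R.
Proof.
move=> n0 nB; have FDk k : F (n + D * k) = F n.
  by elim: k => [|k IH]; rewrite ?muln0 ?addn0 // mulnS addnCA addnC FD.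
transitivity (\sum_(0 <= k < K) F (n + D * k)).
  under eq_bigr do rewrite FDk.
  by rewrite sumr_const_nat subn0 mulr_natl.
transitivity (\sum_(0 <= k < K) \sum_(1 <= d < B.+1) F' d * (d %| n + D * k)%:R).
  rewrite !big_nat; apply: eq_bigr => k kK.
  rewrite -[LHS](@mobius_inversion R F) ?addn_gt0 ?n0 //.
  (* The range up to [B] contains the divisors of every term of the progression, so it can be the
     same for all [k]. *)
  rewrite (big_divisors_nat _ _ (B := B)) ?addn_gt0 ?n0 //; last first.
    by apply: leq_trans nB; rewrite leq_add2l leq_mul2l ltnW ?orbT.
  by rewrite big_mkcond; apply: eq_bigr => d _; case: ifP; rewrite ?mulr1 ?mulr0.
rewrite exchange_big /=; apply: eq_bigr => d _.
by rewrite natr_sum mulr_sumr.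
Qed.

Lemma dilation_close h (e : R) : (0 < h)%N -> 0 < e ->
  exists K, [/\ (0 < K)%N, (D %| K)%N & forall u, (0 < u)%N -> (u <= K)%N ->
    coprime u K -> `|F h - F (u * h)| <= e].
Proof.
move=> h0 e0; have hD0 : 0 < (h + D)%:R :> R by rewrite ltr0n addn_gt0 h0.
(* The tail is made at most [e / (h + D)] because it will be weighted by [K * (h + D)]. *)
have [M HM] := wintner_tail (divr_gt0 e0 hD0).
(* A factorial, so that [D] and every positive [d <= M] divide [K]. *)
pose K := (maxn M D)`!; exists K; have K0 : (0 < K)%N by exact: fact_gt0.
split => //; first by rewrite dvdn_fact // D0 leq_maxr.
move=> u u0 uK cu; pose B := (h + u * h + D * K + M)%N.
have K0R : 0 < K%:R :> R by rewrite ltr0n.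
rewrite -(ler_pM2l K0R) -{1}(gtr0_norm K0R) -normrM mulrBr.
rewrite !(@sum_progression _ K B) ?muln_gt0 ?u0 //; try by rewrite /B; lia.
rewrite -sumrB (le_trans (ler_norm_sum _ _ _)) // big_add1 /=.
pose A n d := (\sum_(0 <= k < K) (d %| n + D * k))%N.
(* Since [u * h + D * (u * k) = u * (h + D * k)] with [u] prime to [d], the permutation
   [k |-> u * k] mod [K] matches the two counts. *)
have AM d : (0 < d)%N -> (d <= M)%N -> A h d = A (u * h)%N d.
  move=> d0 dM; have dK : (d %| K)%N by rewrite dvdn_fact // d0 leq_max dM.
  rewrite /A -(@sum_period_mul _ K (fun k => d %| u * h + D * k : nat) K0 _ u) //.
    apply: eq_bigr => k _; rewrite mulnCA -mulnDr Gauss_dvdr //.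
    by rewrite coprime_sym (coprime_dvdr dK).
  move=> k; congr nat_of_bool; rewrite /dvdn -modnDmr -modnMmr modn_dvdm //.
  by rewrite modnMmr modnDmr.
(* Both [h] and [u * h] are at most [K * h], which makes the bound uniform in [u]. *)
have AK n d : (0 < d)%N -> (0 < n)%N -> (n <= K * h)%N ->
    (A n d)%:R <= K%:R * (h + D)%:R / d%:R :> R.
  move=> d0 n0 nK; rewrite ler_pdivlMr ?ltr0n // -!natrM ler_nat.
  by apply: leq_trans (count_dvd_progression _ n0 D0 d0) _; nia.
rewrite (@big_cat_nat _ _ _ M) //=; last by rewrite /B leq_addl.
rewrite big_nat big1 ?add0r; last first.
  by move=> j /andP[_ jM]; rewrite -/(A _ _) -/(A _ _) AM // subrr normr0.
apply: (@le_trans _ _ (\sum_(M <= j < B) (K%:R * (h + D)%:R) * (`|F' j.+1| /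
  j.+1%:R))).
  apply: ler_sum => j _; rewrite -mulrBr normrM mulrCA ler_wpM2l //.
  (* Both counts lie between 0 and the same bound, and so does the modulus of their difference. *)
  rewrite ler_norml -/(A _ _) -/(A _ _).
  have a1 := @AK h j.+1 isT h0 (leq_pmull h K0).
  have uh0 : (0 < u * h)%N by rewrite muln_gt0 u0.
  have uhK : (u * h <= K * h)%N by rewrite leq_mul2r uK orbT.
  have a2 := @AK (u * h)%N j.+1 isT uh0 uhK.
  move: a1 a2 (ler0n R (A h j.+1)) (ler0n R (A (u * h)%N j.+1)).
  move: (A h j.+1)%:R (A (u * h)%N j.+1)%:R (_ / _) => x y z *.
  by apply/andP; split; lra.
rewrite -mulr_sumr -mulrA ler_pM2l // mulrC -ler_pdivlMr //.
by apply: HM; rewrite /B leq_addl.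
Qed.

End Dilation.
End Wintner.

(** * The exact singular series *)

Section Expansion.
Variable R : realType.
Implicit Types (m n q d K h u N : nat).

Local Notation ram := (@ram R).
Local Notation Lambda := (@Lambda R).
Local Notation hat := (@Lambda_trunc_hat R).
Local Notation corr N := (correlation Lambda (@Lambda_trunc R N) N).

(** The indicator of [d %| n] is the sum of [c_q n / d] over [q %| d]. Exchanging and writing
    [d = q * d'], the Moebius value splits if [q] and [d'] are coprime and vanishes otherwise. *)
Lemma Lambda_trunc_expansion N n :
  Lambda_trunc R N n = \sum_(1 <= q < N.+1) hat N q * ram q n.
Proof.
transitivity (- \sum_(1 <= d < N.+1) \sum_(1 <= q < N.+1 | (q %| d)%N)
    (mobius d)%:~R * ln d%:R / d%:R * ram q n).
  rewrite /Lambda_trunc; congr (- _); rewrite big_mkcond !big_nat.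
  apply: eq_bigr => d /andP[d0 dN]; rewrite -mulr_sumr -big_divisors_nat //.
  rewrite sum_ram_divisors // natrM mulrA divfK ?pnatr_eq0 -?lt0n //.
  by case: (d %| n)%N; rewrite ?mulr1 ?mulr0.
rewrite (exchange_big_dep xpredT) //= -sumrN !big_nat;
  apply: eq_bigr => q /andP[q0 qN].
rewrite -mulr_suml -mulNr; congr (_ * _); rewrite /Lambda_trunc_hat mulNr;
  congr (- _).
rewrite big_nat_dvd // mulr_sumr [RHS]big_mkcond !big_nat.
apply: eq_bigr => d /andP[d0 _]; case: ifP => cdq; last first.
  by rewrite mobius_ncoprime ?mul0r // coprime_sym cdq.
rewrite mobius_coprime //; last by rewrite coprime_sym.
rewrite rmorphM /= (mulnC q d) [in _^-1]natrM.
by field; rewrite !pnatr_eq0 -!lt0n d0 q0.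
Qed.

Lemma correlation_expansion N n : corr N n =
  \sum_(1 <= q < N.+1) hat N q * \sum_(1 <= m < N.+1) Lambda m * ram q (m + n).
Proof.
rewrite /correlation; under eq_bigr do rewrite Lambda_trunc_expansion mulr_sumr.
rewrite exchange_big /=; apply: eq_bigr => q _; rewrite mulr_sumr.
by apply: eq_bigr => m _; rewrite mulrCA.
Qed.

(** [Lambda_trunc N] only tests divisibility by [d <= N], and each such [d] divides the factorial of
    [N]. *)
Lemma correlation_periodic N n : corr N (n + N`!) = corr N n.
Proof.
apply: eq_bigr => m _; congr (_ * - _); rewrite big_nat_cond [RHS]big_nat_cond.
apply: eq_bigl => d; case/boolP: (1 <= d < N.+1)%N => //= /andP[d0 dN].
by rewrite addnA dvdn_addl // dvdn_fact // d0.
Qed.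

Lemma totient_neq0 q : (0 < q)%N -> (totient q)%:R != 0 :> R.
Proof. by move=> q0; rewrite pnatr_eq0 -lt0n totient_gt0. Qed.

Lemma sum_unit_correlation N K h : (0 < K)%N -> (N`! %| K)%N ->
  \sum_(1 <= u < K.+1 | coprime u K) corr N (u * h) =
  (totient K)%:R * \sum_(1 <= q < N.+1) hat N q *
    \sum_(1 <= m < N.+1) Lambda m * (ram q m * ram q h / (totient q)%:R).
Proof.
move=> K0 NK; under eq_bigr do rewrite correlation_expansion.
rewrite exchange_big /= mulr_sumr !big_nat; apply: eq_bigr => q /andP[q0 qN].
rewrite -mulr_sumr [RHS]mulrCA; congr (_ * _).
rewrite exchange_big /= mulr_sumr; apply: eq_bigr => m _.
rewrite -mulr_sumr [RHS]mulrCA; congr (_ * _).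
have qK : (q %| K)%N by apply: dvdn_trans NK; rewrite dvdn_fact // q0.
by rewrite mulrA -ram_unit_average // mulfK ?totient_neq0.
Qed.

Definition wintner_cvg N :=
  cvgn (series (fun j => eratosthenes_wintner_term R N j.+1)).

Lemma correlation_singular N h : (0 < h)%N -> wintner_cvg N ->
  corr N h = \sum_(1 <= q < N.+1) hat N q *
    \sum_(1 <= m < N.+1) Lambda m * (ram q m * ram q h / (totient q)%:R).
Proof.
move=> h0 cvN; set V := RHS; apply/eqP; rewrite -subr_eq0 -normr_le0.
apply/ler_addgt0Pl => e e0; rewrite addr0.
have [|||||K [K0 NK close]] := @dilation_close R (corr N) N`! _ _ _ h e => //.
- exact: fact_gt0.
- exact: correlation_periodic.
(* The weight [2 ^+ omega m] is at least 1, so the hypothesis dominates the series without it. *)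
- apply: series_le_cvg cvN => j; rewrite ?divr_ge0 //.
    by rewrite mulr_ge0 ?divr_ge0 ?exprn_ge0.
  rewrite mulrC -[leRHS]mulrA ler_peMl ?mulr_ge0 ?invr_ge0 // exprn_ege1 //.
  by rewrite ler1n.
have T0 : 0 < (totient K)%:R :> R by rewrite ltr0n totient_gt0.
(* Multiplied by [totient K], the difference is a sum over units [u] of [corr N h - corr N (u * h)],
   each at most [e] in modulus. *)
rewrite -(ler_pM2l T0) -{1}(gtr0_norm T0) -normrM mulrBr -sum_unit_correlation //.
rewrite totient_count // !natr_sum !mulr_suml -sumrB.
rewrite (le_trans (ler_norm_sum _ _ _)) // big_nat_cond [leRHS]big_nat_cond.
by apply: ler_sum => u /andP[/andP[u0 uK] cu]; rewrite !mul1r close.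
Qed.

(** Unit invariance reduces to [c_q 1], where only the divisor 1 contributes. *)
Lemma ram_coprime m q : (0 < q)%N -> coprime m q -> ram q m = (mobius q)%:~R.
Proof.
move=> q0 cmq; rewrite -[m]muln1 ram_unit // /ram big_divisors_rev //.
rewrite (bigD1_seq 1%N) ?divisors_uniq ?divisor1 //= divn1 divnn q0 dvdnn mulr1.
rewrite big_seq_cond big1 ?addr0 // => d /andP[].
rewrite -dvdn_divisors // => dq /negPf d1.
by rewrite divnA // mulKn // dvdn1 d1 muln0 mulr0.
Qed.

(* The deviation of [c_q (m + h)] from its mean over the dilations [h |-> u * h]. *)
Definition ram_defect q m h : R :=
  ram q (m + h) - ram q m * ram q h / (totient q)%:R.

(** The classes in [psi] are merged into one sum over [m] prime to [q]; for such [m],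
    [mobius q = c_q m] turns [delta] into [ram_defect]. *)
Lemma DeltaE N h : Delta R N h%:Z =
  (\sum_(1 <= q < N.+1) hat N q *
    \sum_(1 <= m < N.+1 | coprime m q) Lambda m * ram_defect q m h)%:C.
Proof.
rewrite rmorph_sum /= /Delta !big_nat; apply: eq_bigr => q /andP[q0 _].
rewrite [RHS]rmorphM /=; congr (_ * _).
pose E k : R := ram q (k + h) - (mobius q)%:~R / (totient q)%:R * ram q h.
have EqK k : E (k %% q)%N = E k.
  by rewrite /E -(ram_mod _ (_ + h) q0 (dvdnn q)) modnDml ram_mod.
transitivity (\sum_(1 <= k < q.+1 | coprime k q) (psi R N q k * E k))%:C.
  rewrite rmorph_sum /=; apply: eq_bigr => k _; rewrite rmorphM /=; congr (_ * _).
  rewrite /delta -PoszD !ramanujan_sumE // /E rmorphB /= !rmorphM /=.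
  by rewrite fmorphV rmorph_int rmorph_nat.
congr (_%:C); under [LHS]eq_bigr do rewrite /psi mulr_suml.
rewrite (exchange_big_dep xpredT) //= [RHS]big_mkcond /=; apply: eq_bigr => m _.
rewrite -mulr_sumr sum_unit_eqmod //; case: ifP => cm; last by rewrite mulr0.
congr (_ * _); rewrite /ram_defect (ram_coprime q0 cm) /E; congr (_ - _).
by rewrite mulrAC.
Qed.

(** Subtracting the singular series from the finite expansion shows that the defects over all [m]
    sum to zero, so the coprime part is minus the other part. *)
Lemma Delta_noncoprime N h : (0 < h)%N -> wintner_cvg N -> Delta R N h%:Z =
  (- \sum_(1 <= q < N.+1) hat N q *
    \sum_(1 <= m < N.+1 | ~~ coprime m q) Lambda m * ram_defect q m h)%:C.
Proof.
move=> h0 cvN; rewrite DeltaE; congr (_%:C); apply/eqP; rewrite -subr_eq0 opprK.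
rewrite -big_split /=.
have := correlation_singular h0 cvN; rewrite correlation_expansion => /eqP.
rewrite -subr_eq0 -sumrB => /eqP S0; apply/eqP.
rewrite -[RHS]S0; apply: eq_bigr => q _.
rewrite -mulrDr -mulrBr; congr (_ * _); rewrite -sumrB.
rewrite [RHS](bigID (fun m => coprime m q)) /=.
by congr (_ + _); apply: eq_bigr => m _; rewrite -mulrBr.
Qed.

End Expansion.

(** * The divisor bound *)

Lemma size_divisors_primepow p a m : prime p -> (0 < m)%N -> ~~ (p %| m)%N ->
  (size (divisors (p ^ a * m)) <= a.+1 * size (divisors m))%N.
Proof.
move=> pp m0 pm.
pose s := [seq (p ^ i * d)%N | i <- iota 0 a.+1, d <- divisors m].
have -> : (a.+1 * size (divisors m) = size s)%N by rewrite size_allpairs size_iota.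
apply: uniq_leq_size; first exact: divisors_uniq.
have N0 : (0 < p ^ a * m)%N by rewrite muln_gt0 expn_gt0 prime_gt0.
move=> d; rewrite -dvdn_divisors // => dN.
have [e cpe de] := pfactor_coprime pp (dvdn_gt0 N0 dN).
apply/allpairsP; exists (logn p d, e); rewrite mem_iota /= add0n ltnS.
split; last by rewrite mulnC.
  rewrite -(@dvdn_Pexp2l p) ?prime_gt1 // -(@Gauss_dvdl _ _ m); last first.
    by rewrite coprimeXl // prime_coprime.
  by apply: dvdn_trans dN; rewrite [X in (_ %| X)%N]de dvdn_mull.
rewrite -dvdn_divisors // -(@Gauss_dvdr _ (p ^ a)%N); last first.
  by rewrite coprime_sym coprimeXl.
by apply: dvdn_trans dN; rewrite de dvdn_mulr.
Qed.

Section Growth.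
Variable R : realType.
Implicit Types (m n q d h u N p a : nat) (e : R).

Lemma powR_ge1D (x e : R) : 1 <= x -> 1 + e * ln x <= x `^ e.
Proof.
move=> x1; rewrite /powR gt_eqF; last exact: lt_le_trans ltr01 x1.
exact: expR_ge1Dx.
Qed.

Lemma ln_bound e : 0 < e -> exists2 C : R, 1 <= C &
  forall n, (0 < n)%N -> 1 + ln n%:R <= C * n%:R `^ e.
Proof.
move=> e0; exists (1 + e^-1); first by rewrite lerDl invr_ge0 ltW.
move=> n n0; have n1 : 1 <= n%:R :> R by rewrite ler1n.
have L0 := ln_ge0 n1; have ei : 0 < e^-1 by rewrite invr_gt0.
apply: (@le_trans _ _ ((1 + e^-1) * (1 + e * ln n%:R))); last first.
  by rewrite ler_wpM2l ?addr_ge0 ?powR_ge1D // ltW.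
rewrite mulrDl mul1r mulrDr mulr1 mulKf ?gt_eqF //.
by have := mulr_ge0 (ltW e0) L0; lra.
Qed.

Lemma powR_natX p a e : (p ^ a)%:R `^ e = (p%:R `^ e) ^+ a :> R.
Proof.
elim: a => [|a IH]; first by rewrite expr0 powR1.
by rewrite expnS natrM powRM // IH exprS.
Qed.

(** The ratio of the two sides is controlled prime by prime: the factor [(a + 1) / p ^ (a * e)] is
    at most [c] always, and at most 1 once [p ^ e >= 2]. *)
Lemma divisor_bound e : 0 < e -> exists2 C : R, 1 <= C &
  forall n, (0 < n)%N -> (size (divisors n))%:R <= C * n%:R `^ e.
Proof.
move=> e0; have ln2 : 0 < ln 2 :> R by rewrite ln_gt0 // ltr1n.
have el : 0 < e * ln 2 by rewrite mulr_gt0.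
(* Both [c >= 1] and [c * e * ln 2 >= 1], whence [a + 1 <= c * (1 + a * e * ln 2)]. *)
pose c : R := 1 + (e * ln 2)^-1.
have c1 : 1 <= c by rewrite lerDl invr_ge0 ltW.
pose B := (Num.truncn (2 `^ e^-1 : R)).+1.
have small p a : prime p -> a.+1%:R <= c * (p%:R `^ e) ^+ a.
  move=> pp; have p2 : 2 <= p%:R :> R by rewrite ler_nat prime_gt1.
  apply: (@le_trans _ _ (c * (1 + e * ln 2 * a%:R))).
    rewrite -natr1 /c mulrDl mul1r mulrDr mulr1 mulKf ?gt_eqF //.
    have : 0 <= e * ln 2 * a%:R by rewrite mulr_ge0 // ltW.
    have : 0 < (e * ln 2)^-1 by rewrite invr_gt0.
    by lra.
  rewrite ler_wpM2l //; first by apply: le_trans c1.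
  rewrite -powR_natX (le_trans _ (@powR_ge1D _ _ _)) ?ler1n ?expn_gt0 ?prime_gt0 //.
  rewrite lerD2l -mulrA ler_pM2l // natrX lnXn; last by apply: lt_le_trans p2.
  by rewrite -[leRHS]mulr_natr ler_wpM2r // ler_ln ?posrE // (lt_le_trans _ p2).
have large p a : prime p -> (B <= p)%N -> a.+1%:R <= (p%:R `^ e) ^+ a.
  move=> pp Bp; apply: (@le_trans _ _ (2 ^+ a)).
    by rewrite -natrX ler_nat ltn_expl.
  have pow2 : 2 = (2 `^ e^-1) `^ e :> R by rewrite -powRrM mulVf ?gt_eqF // powRr1.
  have p2e : 2 <= p%:R `^ e :> R.
    rewrite [leLHS]pow2 ge0_ler_powR ?nnegrE ?powR_ge0 ?(ltW e0) //.
    by rewrite (le_trans (ltW (truncnS_gt _))) // ler_nat.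
  by rewrite lerXn2r ?nnegrE ?powR_ge0.
(* Counting only primes below [B] suits the induction: peeling off [p ^ a] costs a factor [c] for a
   small prime and nothing for a large one. *)
suff main n : (0 < n)%N -> (size (divisors n))%:R <=
    c ^+ count (fun p => (p < B)%N) (primes n) * n%:R `^ e.
  exists (c ^+ B); first by rewrite exprn_ege1.
  move=> n n0; apply: le_trans (main n n0) _; rewrite ler_wpM2r ?powR_ge0 //.
  rewrite ler_weXn2l // -size_filter -[leqRHS](size_iota 0).
  apply: uniq_leq_size; first by rewrite filter_uniq ?primes_uniq.
  by move=> p; rewrite mem_filter mem_iota add0n => /andP[].
have [k] := ubnP n; elim: k n => // k IH n; rewrite ltnS => nk n0.
have [->|n1] := eqVneq n 1%N; first by rewrite /= powR1 mulr1.
have [|p [a [m [pp a0 m0 pm en]]]] := @pdiv_split n.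
  by rewrite ltn_neqAle eq_sym n1.
have mn : (m < n)%N.
  by rewrite en ltn_Pmull // -{1}(expn0 p) ltn_exp2l ?prime_gt1.
have pe0 : 0 <= (p%:R `^ e) ^+ a :> R by rewrite exprn_ge0 // powR_ge0.
have W0 : 0 <= c ^+ count (fun p => (p < B)%N) (primes m) * m%:R `^ e.
  by rewrite mulr_ge0 ?powR_ge0 // exprn_ge0 // (le_trans _ c1).
have pma : coprime (p ^ a) m by rewrite coprimeXl // prime_coprime.
rewrite en (permP (perm_primesM _ m0 pma)) ?expn_gt0 ?prime_gt0 //.
rewrite primesX // primes_prime //= natrM powRM // powR_natX.
apply: (@le_trans _ _ (a.+1%:R * (size (divisors m))%:R)).
  by rewrite -natrM ler_nat size_divisors_primepow.
have IHm := IH m (leq_trans mn nk) m0.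
apply: (@le_trans _ _ (a.+1%:R *
    (c ^+ count (fun p => (p < B)%N) (primes m) * m%:R `^ e))).
  by rewrite ler_wpM2l.
have [pB|Bp] := ltnP p B.
  rewrite /= add1n exprS mulrACA; exact: ler_wpM2r W0 _ _ (small p a pp).
rewrite /= add0n [leRHS]mulrCA; exact: ler_wpM2r W0 _ _ (large p a pp Bp).
Qed.

Lemma harmonic_le n : (0 < n)%N -> \sum_(1 <= q < n.+1) (q%:R)^-1 <= 1 + ln
  n%:R :> R.
Proof.
elim: n => // -[_ _|n IH _]; first by rewrite big_nat1 invr1 ln1 addr0.
(* This is [ln (1 + x) <= x] at [x = - n.+2%:R^-1]. *)
suff D : n.+2%:R^-1 <= ln n.+2%:R - ln n.+1%:R :> R.
  rewrite big_nat_recr //= (le_trans (lerD (IH isT) D)) //.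
  by rewrite -addrA (addrC (ln _)) subrK.
rewrite -ln_div ?posrE // -[_ / _]invrK lnV ?posrE ?invr_gt0 ?divr_gt0 //.
rewrite invf_div lerNr.
have -> : n.+1%:R / n.+2%:R = 1 + - n.+2%:R^-1 :> R.
  have n2 : n.+2%:R != 0 :> R by rewrite pnatr_eq0.
  apply: (mulIf n2); rewrite divfK // mulrDl mulNr mulVf // mul1r.
  by rewrite -[n.+2%:R]natr1 addrK.
rewrite le_ln1Dx // ltrN2 invf_lt1 // ltr1n //.
Qed.

End Growth.

(** * Estimates *)

Section Estimate.
Variable R : realType.
Implicit Types (m n q d h r u N p a : nat).

Local Notation ram := (@ram R).
Local Notation Lambda := (@Lambda R).
Local Notation hat := (@Lambda_trunc_hat R).

(** Pairing [d] with [p * d] leaves [ln p] times the sum of [mobius d] over [d %| m]. *)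
Lemma Lambda_primepow_mul p a m : prime p -> (0 < a)%N -> (0 < m)%N ->
  ~~ (p %| m)%N -> Lambda (p ^ a * m) = ln p%:R * (m == 1%N)%:R.
Proof.
move=> pp a0 m0 pm; rewrite /Lambda (sum_mobius_primepow (fun d => ln d%:R)) //.
rewrite -(sum_mobius R m0) mulr_sumr -sumrN !big_seq; apply: eq_bigr => d.
rewrite -dvdn_divisors // => dm; have d0 := dvdn_gt0 m0 dm.
rewrite natrM lnM ?posrE ?ltr0n ?(prime_gt0 pp) //.
by rewrite opprD addrCA subrr addr0 mulrN opprK mulrC.
Qed.

Lemma Lambda_neq0 n : (0 < n)%N -> Lambda n != 0 ->
  exists p a, [/\ prime p, (0 < a)%N, n = (p ^ a)%N & Lambda n = ln p%:R].
Proof.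
move=> n0; have [->|n1] := eqVneq n 1%N.
  by rewrite /Defs.Lambda big_seq1 ln1 mulr0 oppr0 eqxx.
have [|p [a [m [pp a0 m0 pm ->]]]] := @pdiv_split n.
  by rewrite ltn_neqAle eq_sym n1.
rewrite Lambda_primepow_mul //; case: (m =P 1%N) => [->|];
  last by rewrite mulr0 eqxx.
by move=> _; exists p, a; rewrite muln1 mulr1.
Qed.

Lemma norm_ram_le q n : (0 < q)%N ->
  `|ram q n| <= \sum_(d <- divisors q | (d %| n)%N) d%:R.
Proof.
move=> q0; rewrite /ram big_divisors_rev // [leRHS]big_mkcond /=.
rewrite (le_trans (ler_norm_sum _ _ _)) // big_seq [leRHS]big_seq.
apply: ler_sum => d; rewrite -dvdn_divisors // => dq.
rewrite divnA // mulKn // normrM normr_nat natrM.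
by case: (d %| n)%N; rewrite ?mulr0 // mulr1 ler_piMl ?norm_mobius_le1.
Qed.

Lemma norm_expi (t : R) : `|expi t| = 1.
Proof. by rewrite normc_def /= cos2Dsin2 sqrtr1. Qed.

Lemma norm_real_complex (x : R) : `|x%:C| = `|x|%:C.
Proof. by rewrite normc_def /= expr0n addr0 sqrtr_sqr. Qed.

Lemma norm_ram_le_totient q n : (0 < q)%N -> `|ram q n| <= (totient q)%:R.
Proof.
move=> q0; rewrite -lecR -norm_real_complex -ramanujan_sumE // rmorph_nat.
rewrite (le_trans (ler_norm_sum _ _ _)) // totient_count // natr_sum.
by apply: ler_sum => j _; rewrite norm_expi.
Qed.

(** Multiplicativity of [c_q] in [q]; the first factor is [c_p n]. *)
Lemma ram_primeM p r n : prime p -> (0 < r)%N -> ~~ (p %| r)%N ->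
  ram (p * r) n = ((p * (p %| n))%:R - 1) * ram r n.
Proof.
move=> pp r0 pr; have p0 := prime_gt0 pp.
rewrite /ram -[X in divisors (X * r)]expn1.
rewrite (sum_mobius_primepow
  (fun d => ((p * r) %/ d * ((p * r) %/ d %| n))%:R)) //.
rewrite mulr_sumr !big_seq; apply: eq_bigr => d; rewrite -dvdn_divisors // => dr.
have d0 := dvdn_gt0 r0 dr.
rewrite mulrCA; congr (_ * _); rewrite divnMl // -muln_divA //.
rewrite Gauss_dvd; last first.
  rewrite prime_coprime //; apply: contra pr => /dvdn_trans; apply.
  exact: dvdn_div.
by rewrite mulrBl mul1r -natrM mulnACA mulnb.
Qed.

(** Bound [c_q n] by the sum of the common divisors [d] of [q] and [n]; after exchanging, each
    [d %| n] contributes a harmonic sum over [q %/ d]. *)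
Lemma sum_ram_le N n : (0 < n)%N -> (0 < N)%N ->
  \sum_(1 <= q < N.+1) `|ram q n| / q%:R <= (size (divisors n))%:R * (1 + ln N%:R).
Proof.
move=> n0 N0.
apply: (@le_trans _ _ (\sum_(1 <= q < N.+1) \sum_(d <- divisors n | (d %| q)%N)
  d%:R / q%:R)).
  rewrite !big_nat; apply: ler_sum => q /andP[q0 _].
  rewrite -mulr_suml ler_wpM2r ?invr_ge0 //.
  apply: le_trans (norm_ram_le n q0) _.
  rewrite -big_filter -[leRHS]big_filter (perm_big [seq d <- divisors n | (d %|
    q)%N]) //.
  apply: uniq_perm => [||d]; rewrite ?filter_uniq ?divisors_uniq //.
  by rewrite !mem_filter -!dvdn_divisors // andbC.
rewrite (exchange_big_dep xpredT) //=.
apply: (@le_trans _ _ (\sum_(d <- divisors n) (1 + ln N%:R))); last first.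
  by rewrite big_const_seq count_predT iter_addr_0 mulr_natl.
rewrite big_seq [leRHS]big_seq; apply: ler_sum => d;
  rewrite -dvdn_divisors // => dn.
have d0 := dvdn_gt0 n0 dn; rewrite big_nat_dvd //.
apply: le_trans (harmonic_le R N0).
have dN : (N %/ d <= N)%N by exact: leq_div.
rewrite [leRHS](@big_cat_nat _ _ _ (N %/ d).+1) //= ler_wpDr //.
  by rewrite sumr_ge0 // => q _; rewrite invr_ge0.
apply: ler_sum => q _.
by rewrite natrM invfM mulrA divff ?mul1r // pnatr_eq0 -lt0n.
Qed.

(** One logarithmic factor comes from [ln (d * q) <= ln N], the other from the harmonic sum over
    [d]. *)
Lemma norm_hat_le N q : (0 < q)%N -> (q <= N)%N ->
  `|hat N q| <= (1 + ln N%:R) ^+ 2 / q%:R.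
Proof.
move=> q0 qN; have N0 : (0 < N)%N by apply: leq_trans qN.
have L0 : 0 <= ln N%:R :> R by rewrite ln_ge0 // ler1n.
have L1 : 0 <= 1 + ln N%:R :> R by rewrite addr_ge0.
rewrite /Lambda_trunc_hat normrM normrN normrM normfV normr_nat mulrAC
  ler_wpM2r ?invr_ge0 //.
rewrite -[leRHS]mul1r ler_pM ?norm_mobius_le1 //.
rewrite (le_trans (ler_norm_sum _ _ _)) //.
apply: (@le_trans _ _ (\sum_(1 <= d < (N %/ q).+1) (1 + ln N%:R) * d%:R^-1)).
  rewrite big_mkcond !big_nat; apply: ler_sum => d /andP[d0 dN].
  case: ifP => _; last by rewrite mulr_ge0 // invr_ge0.
  rewrite !normrM normfV normr_nat ler_wpM2r ?invr_ge0 //.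
  have dq1 : 1 <= (d * q)%:R :> R by rewrite ler1n muln_gt0 d0.
  rewrite -[leRHS]mul1r ler_pM ?norm_mobius_le1 // ger0_norm ?ln_ge0 //.
  rewrite ler_wpDl // ler_ln ?posrE ?ltr0n ?muln_gt0 ?d0 // ler_nat.
  by move: dN; rewrite ltnS leq_divRL.
rewrite -mulr_sumr expr2 ler_wpM2l //.
have qq : (0 < N %/ q)%N by rewrite divn_gt0.
apply: le_trans (harmonic_le _ qq) _; rewrite lerD2l ler_ln ?posrE ?ltr0n //.
by rewrite ler_nat leq_div.
Qed.

Lemma hat_sqr0 N p r : prime p -> (0 < r)%N -> (p %| r)%N -> hat N (p * r) = 0.
Proof.
move=> pp r0 pr; rewrite /Lambda_trunc_hat (@mobius_sqr0 p) ?mul0r ?oppr0 ?mul0r //.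
  by rewrite muln_gt0 prime_gt0.
by rewrite -mulnn dvdn_pmul2l ?prime_gt0.
Qed.

Lemma norm_ram_primepow p a r : prime p -> (0 < a)%N -> (0 < r)%N ->
  ~~ (p %| r)%N -> `|ram (p * r) (p ^ a)| <= p%:R - 1.
Proof.
move=> pp a0 r0 pr; rewrite ram_primeM // dvdn_exp // muln1.
rewrite ram_coprime //; last by rewrite coprimeXl // prime_coprime.
have p1 : 0 <= p%:R - 1 :> R by rewrite subr_ge0 ler1n prime_gt0.
by rewrite normrM (ger0_norm p1) ler_piMr ?norm_mobius_le1.
Qed.

(** The loss of [p] is affordable because this bound is applied only at primes dividing [h]. *)
Lemma norm_defect_dvd p a r h : prime p -> (0 < a)%N -> (0 < r)%N ->
  ~~ (p %| r)%N ->
  `|ram_defect R (p * r) (p ^ a) h| <= `|ram (p * r) (p ^ a + h)| + p%:R.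
Proof.
move=> pp a0 r0 pr; have q0 : (0 < p * r)%N by rewrite muln_gt0 prime_gt0.
rewrite (le_trans (ler_normB _ _)) // lerD2l !normrM normfV normr_nat -mulrA.
have T0 : 0 < (totient (p * r))%:R :> R by rewrite ltr0n totient_gt0.
apply: (@le_trans _ _ ((p%:R - 1) * 1)); last by rewrite mulr1 lerBlDr lerDl.
rewrite ler_pM ?norm_ram_primepow ?divr_ge0 //.
by rewrite ler_pdivrMr // mul1r norm_ram_le_totient.
Qed.

(** As [p] divides neither [h] nor [p ^ a + h], both sums carry the factor [c_p = -1], and the
    [p - 1] from [c_q (p ^ a)] cancels against [totient p]: no power of [p] remains. *)
Lemma norm_defect_ndvd p a r h : prime p -> (0 < a)%N -> (0 < r)%N ->
  ~~ (p %| r)%N -> ~~ (p %| h)%N ->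
  `|ram_defect R (p * r) (p ^ a) h| <= `|ram r (p ^ a + h)| + 1.
Proof.
move=> pp a0 r0 pr ph; rewrite (le_trans (ler_normB _ _)) // lerD //.
  rewrite ram_primeM // dvdn_addr ?dvdn_exp // (negbTE ph) muln0 sub0r.
  by rewrite mulN1r normrN.
have p1 : 0 < p.-1%:R :> R by rewrite ltr0n -subn1 subn_gt0 prime_gt1.
have pE : p%:R - 1 = p.-1%:R :> R.
  by rewrite -[p in LHS](prednK (prime_gt0 pp)) -natr1 addrK.
rewrite [ram _ h]ram_primeM // (negbTE ph) muln0 sub0r mulN1r mulrN mulNr normrN.
rewrite totient_coprime ?prime_coprime // totient_prime // natrM.
rewrite !normrM normfV normrM !normr_nat.
have T0 : 0 < (totient r)%:R :> R by rewrite ltr0n totient_gt0.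
rewrite ler_pdivrMr ?mulr_gt0 // mul1r ler_pM ?norm_ram_le_totient //.
by rewrite -pE norm_ram_primepow.
Qed.

End Estimate.

(** * Summation over moduli and prime powers *)

Section DeltaBound.
Variable R : realType.
Implicit Types (m n q d h r u N p a : nat).

Local Notation ram := (@ram R).
Local Notation Lambda := (@Lambda R).
Local Notation hat := (@Lambda_trunc_hat R).
Local Notation defect := (@ram_defect R).

Lemma ler_sum_nat_widen (f : nat -> R) M N : (M <= N)%N -> (forall n, 0 <= f n) ->
  \sum_(1 <= n < M.+1) f n <= \sum_(1 <= n < N.+1) f n.
Proof.
move=> MN f0; rewrite [leRHS](@big_cat_nat _ _ _ M.+1) //= lerDl.
by apply: sumr_ge0 => n _.
Qed.

Lemma sum_dvd_le N h : (0 < h)%N ->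
  \sum_(1 <= p < N.+1) (p %| h)%:R <= (size (divisors h))%:R :> R.
Proof.
move=> h0; apply: (@le_trans _ _ (\sum_(1 <= p < (maxn N h).+1) (p %| h)%:R)).
  by apply: ler_sum_nat_widen; rewrite ?leq_maxl.
rewrite -sum1_size natr_sum (big_divisors_nat _ h0 (leq_maxr N h)).
by rewrite [leRHS]big_mkcond /=; apply: ler_sum => p _; case: ifP => //= ->.
Qed.

Section Bounds.
Variables (N h : nat) (D : R).
Hypotheses (N0 : (0 < N)%N) (h0 : (0 < h)%N) (D1 : 1 <= D).
Hypothesis divD : forall n, (0 < n)%N -> (n <= N + h)%N -> (size (divisors
  n))%:R <= D.

Local Notation L := (1 + ln N%:R : R).

Lemma log_factor_ge1 : 1 <= L.
Proof. by rewrite lerDl ln_ge0 // ler1n. Qed.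

(** Here [q = p * r]. If [p %| h], the defect may have size [p] and offset the [1 / p] in the bound
    for [hat N q]; otherwise that [1 / p] survives. *)
Lemma sum_defect_le p a : prime p -> (0 < a)%N -> (p ^ a <= N)%N ->
  \sum_(1 <= q < N.+1 | ~~ coprime (p ^ a) q) `|hat N q| * `|defect q (p ^ a) h|
  <= 2 * L ^+ 3 * D * ((p %| h)%:R + p%:R^-1).
Proof.
move=> pp a0 paN; have p0 := prime_gt0 pp;
  have p0R : 0 < p%:R :> R by rewrite ltr0n.
have L1 := log_factor_ge1; have L0 : 0 <= L by apply: le_trans L1.
have D0 : 0 <= D by apply: le_trans D1.
have pV : 0 <= p%:R^-1 :> R by rewrite invr_ge0 ltW.
have m0 : (0 < p ^ a + h)%N by rewrite addn_gt0 h0 orbT.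
have sumD : \sum_(1 <= q < N.+1) `|ram q (p ^ a + h)| / q%:R <= D * L.
  apply: le_trans (sum_ram_le _ m0 N0) _; rewrite ler_wpM2r //.
  by rewrite divD // leq_add2r.
have sumH : \sum_(1 <= r < (N %/ p).+1) (r%:R)^-1 <= L :> R.
  apply: le_trans (harmonic_le R N0).
  by apply: ler_sum_nat_widen => [|n]; rewrite ?leq_div ?invr_ge0.
have total : L ^+ 2 * (D * L + L) <= 2 * L ^+ 3 * D.
  have -> : 2 * L ^+ 3 * D = L ^+ 2 * (D * L + D * L) by ring.
  by rewrite ler_wpM2l ?exprn_ge0 // lerD2l ler_peMl.
have sub q : ~~ coprime (p ^ a) q = (p %| q)%N.
  by rewrite coprime_pexpl // prime_coprime // negbK.
rewrite (eq_bigl _ _ sub) big_nat_dvd //.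
have hatL r : (0 < r)%N -> (r < (N %/ p).+1)%N ->
    `|hat N (p * r)| <= L ^+ 2 / (p * r)%:R.
  move=> r0; rewrite ltnS leq_divRL // mulnC => rN.
  by rewrite norm_hat_le // muln_gt0 p0.
have [ph|ph] := boolP (p %| h)%N.
  apply: (@le_trans _ _ (\sum_(1 <= r < (N %/ p).+1)
      L ^+ 2 * (`|ram (p * r) (p ^ a + h)| / (p * r)%:R + r%:R^-1))).
    rewrite !big_nat; apply: ler_sum => r /andP[r0 rN].
    have [pr|pr] := boolP (p %| r)%N.
      by rewrite hat_sqr0 // normr0 mul0r mulr_ge0 ?exprn_ge0 // addr_ge0
        ?divr_ge0 ?invr_ge0.
    (* The summand [p] of the defect bound, divided by [q], becomes the term of a harmonic sum over
       [r]. *)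
    have -> : r%:R^-1 = p%:R / (p * r)%:R :> R.
      by rewrite natrM invfM mulrA divff ?mul1r // gt_eqF.
    rewrite -mulrDl mulrCA [leRHS]mulrC ler_pM ?hatL //.
    exact: norm_defect_dvd.
  rewrite -mulr_sumr big_split /=.
  apply: (@le_trans _ _ (2 * L ^+ 3 * D)); last first.
    by rewrite ler_peMr ?mulr_ge0 ?exprn_ge0 // lerDl.
  apply: le_trans total; rewrite ler_wpM2l ?exprn_ge0 // lerD //.
  apply: le_trans sumD.
  rewrite -(big_nat_dvd N (fun q => `|ram q (p ^ a + h)| / q%:R)) //
    [leLHS]big_mkcond.
  by apply: ler_sum => q _; case: ifP => // _; rewrite divr_ge0.
rewrite add0r.
apply: (@le_trans _ _ (\sum_(1 <= r < (N %/ p).+1)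
    L ^+ 2 / p%:R * (`|ram r (p ^ a + h)| / r%:R + r%:R^-1))).
  rewrite !big_nat; apply: ler_sum => r /andP[r0 rN].
  have [pr|pr] := boolP (p %| r)%N.
    by rewrite hat_sqr0 // normr0 mul0r mulr_ge0 ?divr_ge0 ?exprn_ge0 //
      addr_ge0 ?divr_ge0 ?invr_ge0.
  have -> : L ^+ 2 / p%:R * (`|ram r (p ^ a + h)| / r%:R + r%:R^-1) =
      L ^+ 2 / (p * r)%:R * (`|ram r (p ^ a + h)| + 1).
    by rewrite natrM invfM; ring.
  by rewrite ler_pM ?hatL ?norm_defect_ndvd.
rewrite -mulr_sumr big_split /= mulrAC ler_wpM2r //.
apply: le_trans total; rewrite ler_wpM2l ?exprn_ge0 // lerD //.
apply: le_trans sumD.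
by apply: ler_sum_nat_widen => [|n]; rewrite ?leq_div ?divr_ge0.
Qed.

Lemma trunc_log_ln_le p : prime p -> (trunc_log p N)%:R * ln p%:R <= L.
Proof.
move=> pp; have p0 : 0 < p%:R :> R by rewrite ltr0n prime_gt0.
rewrite mulr_natl -lnXn // -natrX ler_wpDl // ler_ln ?posrE ?ltr0n //.
  by rewrite ler_nat trunc_logP // prime_gt1.
by rewrite expn_gt0 prime_gt0.
Qed.

(** The powers multiply up as [L] from the exponents [a], [2 * L ^+ 3 * D] from the sum over [q],
    and [2 * L * D] from summing [[p | h] + 1 / p] over [p]. *)
Lemma sum_noncoprime_le :
  \sum_(1 <= q < N.+1) `|hat N q| *
    \sum_(1 <= m < N.+1 | ~~ coprime m q) `|Lambda m| * `|defect q m h|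
  <= 4 * L ^+ 5 * D ^+ 2.
Proof.
have L1 := log_factor_ge1; have L0 : 0 <= L by apply: le_trans L1.
have D0 : 0 <= D by apply: le_trans D1.
pose G p : R := 2 * L ^+ 3 * D * ((p %| h)%:R + p%:R^-1).
have G0 p : 0 <= G p by rewrite mulr_ge0 ?addr_ge0 ?invr_ge0 // mulr_ge0 //
  mulr_ge0 ?exprn_ge0.
have lnG p : 0 <= ln p%:R * G p.
  case: p => [|p]; first by rewrite ln0 ?mul0r.
  by rewrite mulr_ge0 // ln_ge0 // ler1n.
(* Prime powers are encoded by the indicator of [m = p ^ a]; all terms being nonnegative, one
   matching pair suffices for the upper bound. *)
apply: (@le_trans _ _ (\sum_(1 <= m < N.+1) \sum_(1 <= p < N.+1 | prime p)
    \sum_(1 <= a < (trunc_log p N).+1) (m == p ^ a)%N%:R * (ln p%:R * G p))).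
  under eq_bigr do rewrite mulr_sumr.
  rewrite (exchange_big_dep xpredT) //= !big_nat; apply: ler_sum => m /andP[m0 mN].
  under eq_bigr do rewrite mulrCA.
  rewrite -mulr_sumr.
  have S0 p a : 0 <= (m == p ^ a)%N%:R * (ln p%:R * G p) by rewrite mulr_ge0.
  have [->|La] := eqVneq (Lambda m) 0.
    by rewrite normr0 mul0r; apply: sumr_ge0 => p _; apply: sumr_ge0.
  have [p [a [pp a0 em Lp]]] := Lambda_neq0 m0 La.
  have p1 := prime_gt1 pp.
  have aN : (a <= trunc_log p N)%N by rewrite trunc_log_max // -em.
  have pN : (p <= N)%N.
    by rewrite -ltnS; apply: leq_ltn_trans mN; rewrite em -{1}(expn1 p) leq_exp2l.
  apply: (@le_trans _ _ (ln p%:R * G p)).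
    rewrite Lp ger0_norm ?ln_ge0 ?ler1n ?(ltnW p1) // ler_wpM2l ?ln_ge0 ?ler1n
      ?(ltnW p1) //.
    by rewrite em sum_defect_le // -em.
  rewrite [leRHS]big_mkcond (bigD1_seq p) ?iota_uniq ?mem_index_iota ?prime_gt0
    //= pp.
  rewrite ler_wpDr //.
    by apply: sumr_ge0 => i _; case: ifP => // _; apply: sumr_ge0.
  rewrite (bigD1_seq a) ?iota_uniq ?mem_index_iota ?a0 //= em eqxx mul1r
    ler_wpDr //.
  by rewrite -em; apply: sumr_ge0.
(* Each [p ^ a] equals at most one [m], and [ln p] summed over the [trunc_log p N] exponents is at
   most [L]. *)
apply: (@le_trans _ _ (\sum_(1 <= p < N.+1) L * G p)).
  rewrite exchange_big /= [leLHS]big_mkcond /=.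
  apply: ler_sum => p _; case: ifP => [pp|_]; last by rewrite mulr_ge0.
  rewrite exchange_big /=.
  apply: (@le_trans _ _ (\sum_(1 <= a < (trunc_log p N).+1) ln p%:R * G p)).
    apply: ler_sum => a _; rewrite -mulr_suml ler_piMl //.
    have [paN|paN] := boolP ((p ^ a)%N \in index_iota 1 N.+1).
      rewrite (bigD1_seq (p ^ a)%N) ?iota_uniq //= eqxx big1 ?addr0 //.
      by move=> i /negbTE ->.
    rewrite big_seq big1 // => i ii; case: eqP => // ei.
    by rewrite -ei ii in paN.
  rewrite sumr_const_nat subn1 /= -[leLHS]mulr_natl mulrA ler_wpM2r //.
  exact: trunc_log_ln_le.
rewrite -mulr_sumr -mulr_sumr big_split /=.
have S1 := sum_dvd_le N h0.
have S2 := divD h0 (leq_addl N h).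
have S3 := harmonic_le R N0.
have S : \sum_(1 <= i < N.+1) (i %| h)%:R + \sum_(1 <= i < N.+1) i%:R^-1 <= 2 *
  (L * D).
  rewrite mulr_natl mulr2n lerD //.
    by rewrite (le_trans S1) // (le_trans S2) // ler_peMl.
  by rewrite (le_trans S3) // ler_peMr.
have -> : 4 * L ^+ 5 * D ^+ 2 = L * (2 * L ^+ 3 * D * (2 * (L * D))) by ring.
by rewrite !ler_wpM2l // !mulr_ge0 ?exprn_ge0.
Qed.

Lemma norm_Delta_le : wintner_cvg R N ->
  `|Delta R N h%:Z| <= (4 * L ^+ 5 * D ^+ 2)%:C.
Proof.
move=> cvN; rewrite Delta_noncoprime // norm_real_complex lecR normrN.
apply: le_trans sum_noncoprime_le.
rewrite (le_trans (ler_norm_sum _ _ _)) //; apply: ler_sum => q _.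
rewrite normrM ler_wpM2l // (le_trans (ler_norm_sum _ _ _)) //.
by apply: ler_sum => m _; rewrite normrM.
Qed.

End Bounds.
End DeltaBound.

Theorem theorem1 (R : realType) (eps : R) (heps : 0 < eps) :
  exists2 K : R, 0 < K &
    forall N0 : nat, (0 < N0)%N ->
    (forall N : nat, (N0 <= N)%N ->
       cvgn (series (fun j : nat => eratosthenes_wintner_term R N j.+1))) ->
    forall h N : nat, (0 < h)%N -> (N0 <= N)%N ->
      `| Delta R N h%:Z | <= (K * (N + h)%:R `^ eps)%:C.
Proof.
(* Five logarithmic and two divisor factors share the exponent equally. The constants [B] and [C]
   are fixed before [N0], [h] and [N]. *)
have d0 : 0 < eps / 7%:R by rewrite divr_gt0.
have [C C1 HC] := divisor_bound d0; have [B B1 HB] := ln_bound d0.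
have C0 : 0 < C by apply: lt_le_trans C1.
have B0 : 0 < B by apply: lt_le_trans B1.
exists (4 * B ^+ 5 * C ^+ 2); first by rewrite !mulr_gt0 ?exprn_gt0.
move=> N0 N00 cvN h N h0 N0N; have Np : (0 < N)%N by apply: leq_trans N0N.
pose X : R := (N + h)%:R `^ (eps / 7%:R).
have X1 : 1 <= X.
  by rewrite -(powRr0 (N + h)%:R) ler_powR ?ler1n ?addn_gt0 ?Np // ltW.
have mono n : (0 < n)%N -> (n <= N + h)%N -> n%:R `^ (eps / 7%:R) <= X.
  by move=> n0 nX; rewrite ge0_ler_powR ?nnegrE ?(ltW d0) // ler_nat.
have CX : 1 <= C * X by rewrite -[1]mul1r ler_pM.
have divX n : (0 < n)%N -> (n <= N + h)%N -> (size (divisors n))%:R <= C * X.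
  move=> n0 nX; apply: le_trans (HC n n0) _.
  by rewrite ler_wpM2l ?mono // ltW.
apply: le_trans (norm_Delta_le Np h0 CX divX (cvN N N0N)) _; rewrite lecR.
have LX : 1 + ln N%:R <= B * X.
  apply: le_trans (HB N Np) _.
  by rewrite ler_wpM2l ?mono ?leq_addr // ltW.
have -> : (N + h)%:R `^ eps = X ^+ 7.
  by rewrite -powR_mulrn ?powR_ge0 // -powRrM divfK // pnatr_eq0.
have -> : 4 * B ^+ 5 * C ^+ 2 * X ^+ 7 = 4 * (B * X) ^+ 5 * (C * X) ^+ 2 by ring.
have L0 : 0 <= 1 + ln N%:R :> R by rewrite addr_ge0 // ln_ge0 // ler1n.
rewrite ler_wpM2r ?exprn_ge0 ?mulr_ge0 ?powR_ge0 ?(ltW C0) //.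
by rewrite ler_wpM2l // lerXn2r ?nnegrE ?mulr_ge0 ?powR_ge0 ?(ltW B0).
Qed.
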